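(* Let $b\ge 2$ and $k\ge 1$ be integers, and write $b=p_1^{l_1}\cdots p_r^{l_r}$ with $p_1,\dots,p_r$ distinct primes and $l_1,\dots,l_r$ positive integers. If $r\ge 2$, assume the primes are numbered so that $$l_1(p_1-1)\ge l_2(p_2-1)\ge\cdots\ge l_r(p_r-1)\quad\text{and}\quad p_1=\max\{p_i : l_i(p_i-1)=l_1(p_1-1)\}.$$ (i) If either $b=p_1^{l_1}$ (that is, $r=1$), or $r\ge 2$ and $l_1(p_1-1)>l_2(p_2-1)$, then the sequence $\{\ell_{b,k}(n!)\}_{n\ge 0}$ is $p_1$-automatic. (ii) If $r\ge 2$ and $l_1(p_1-1)=l_2(p_2-1)$, then the sequence $\{\ell_{b,k}(n!)\}_{n\ge 0}$ is not $m$-automatic for any positive integer $m$; however, it coincides with a $p_1$-automatic sequence on a set of asymptotic density $1$, i.e. there is a $p_1$-automatic sequence $\{\beta(n)\}_{n\ge 0}$ such that the set $\{n\ge 0: \beta(n)=\ell_{b,k}(n!)\}$ has asymptotic density $1$.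
   Context: For positive integers $m$ and $c\ge 2$, $\nu_c(m)$ denotes the largest integer $l$ such that $c^l\mid m$ ($c$ need not be prime), and $m \bmod c$ denotes the residue of $m$ modulo $c$ in $\{0,\dots,c-1\}$. For integers $b\ge 2$, $k\ge 1$, define $\ell_{b,k}(m)=\frac{m}{b^{\nu_b(m)}}\bmod b^k$; it is the number whose base-$b$ expansion is given by the $k$ last nonzero digits of $m$ (i.e. the last $k$ digits of $m$ after removing trailing zeros, padded with leading zeros if necessary). The asymptotic density of a set $A\subset\mathbb{N}$ is $\lim_{n\to\infty}|A\cap\{1,\dots,n\}|/n$, if it exists. Automatic sequences: for finite alphabets $\Sigma,\Delta$, a morphism $\varphi:\Sigma^*\to\Delta^*$ is a map with $\varphi(xy)=\varphi(x)\varphi(y)$ for all words $x,y$; it is $l$-uniform ($l\ge1$) if $|\varphi(x)|=l$ for every letter $x\in\Sigma$, and a coding is a $1$-uniform morphism. A morphism $\varphi:\Sigma^*\to\Sigma^*$ is prolongable on $x\in\Sigma$ if $\varphi(x)=xy$ for some $y\in\Sigma^*$ with $\varphi^i(y)$ nonempty for all $i\ge 0$; then $\varphi^\omega(x)=x\,y\,\varphi(y)\,\varphi^2(y)\cdots$ is the infinite word that has every $\varphi^i(x)$ as a prefix. A sequence $\{\alpha(n)\}_{n\ge 0}$ with values in a finite set $\Delta$, treated as an infinite word, is $l$-automatic if it equals $\tau(\varphi^\omega(x))$ for some finite alphabet $\Sigma$, some $l$-uniform morphism $\varphi:\Sigma^*\to\Sigma^*$ prolongable on some $x\in\Sigma$,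 and some coding $\tau:\Sigma^*\to\Delta^*$. *)

(* Defs.v *)
From mathcomp Require Import all_boot all_order all_algebra.
From mathcomp Require Import all_classical all_reals all_analysis.
Set Implicit Arguments.
Unset Strict Implicit.
Unset Printing Implicit Defensive.
Import numFieldNormedType.Exports.

(* The bound [l < m] loses nothing: if [1 < c], [0 < m] and [c ^ l %| m] then
   [l < c ^ l <= m]; see [nuP]. [logn] is unsuitable, being 0 at composite
   [c]. *)
Definition nu (c m : nat) : nat := \max_(l < m | c ^ l %| m) l.

Lemma nuP (c m : nat) : 1 < c -> 0 < m ->
  c ^ nu c m %| m /\ (forall l, c ^ l %| m -> l <= nu c m).
Proof.
move=> c_gt1 m_gt0; split; last first.
  move=> l dv; have lm : l < m.
    by apply: leq_trans (ltn_expl l c_gt1) _; exact: dvdn_leq.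
  exact: (@leq_bigmax_cond _ (fun i : 'I_m => c ^ i %| m)
    (fun i : 'I_m => nat_of_ord i) (Ordinal lm)).
rewrite /nu; elim/big_ind: _ => [|x y xm ym|//]; first by rewrite dvd1n.
by rewrite /maxn; case: ifP.
Qed.

Definition ell (b k m : nat) : nat := (m %/ b ^ nu b m) %% b ^ k.

Definition word_morphism (S T : Type) (f : seq S -> seq T) : Prop :=
  forall u v, f (u ++ v) = f u ++ f v.

Definition uniform (l : nat) (S T : Type) (f : seq S -> seq T) : Prop :=
  0 < l /\ forall a : S, size (f [:: a]) = l.

Definition coding (S T : Type) (f : seq S -> seq T) : Prop :=
  word_morphism f /\ uniform 1 f.

Definition prolongable (S : Type) (f : seq S -> seq S) (x : S) : Prop :=
  exists y, f [:: x] = x :: y /\ forall i, iter i f y <> [::].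

(* [w] is the infinite word having every [f^i(x)] as a prefix; for [f]
   prolongable on [x] the lengths of these prefixes are unbounded, so [w] is
   unique. *)
Definition omega_word (S : Type) (f : seq S -> seq S) (x : S)
    (w : nat -> S) : Prop :=
  forall i, iter i f [:: x] = mkseq w (size (iter i f [:: x])).

(* [T] may be infinite: the output alphabet is the set of letters produced by
   the coding [tau], which is finite because [Sigma] is. *)
Definition automatic (l : nat) (T : Type) (alpha : nat -> T) : Prop :=
  exists (Sigma : finType) (phi : seq Sigma -> seq Sigma) (x : Sigma)
      (w : nat -> Sigma) (tau : seq Sigma -> seq T),
    [/\ word_morphism phi /\ uniform l phi, prolongable phi x,
        omega_word phi x w, coding tau
      & forall n, tau [:: w n] = [:: alpha n] ].

Definition has_density (R : realType) (A : pred nat) (d : R) : Prop :=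
  ((fun n : nat => (count A (iota 1 n))%:R / n%:R : R) @ \oo --> d)%classic%R.

(* Main.v *)
Require Import Defs.
From mathcomp Require Import all_boot all_order all_algebra.
From mathcomp Require Import all_classical all_reals all_analysis.
From mathcomp Require Import cyclic zify ring.

Set Implicit Arguments.
Unset Strict Implicit.
Unset Printing Implicit Defensive.
Import Order.TTheory GRing.Theory Num.Theory.

(** Write v_p for the p-adic valuation, s_p for the sum of base-p digits, and
    D_i = l_i (p_i - 1).  Legendre's formula v_p(n!) = (n - s_p(n)) / (p - 1)
    shows that v_{p_i}(n!) / l_i is n / D_i up to the digit sum, so the prime
    p_1, whose D_i is largest, tends to have the smallest quotient and hence to
    determine the exponent of b in n!.

    When it does, with room to spare for the other primes (b = p_1^{l_1} w and
    w^(e + k) divides n!, where e = v_{p_1}(n!) / l_1 rounded down), the last k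
    nonzero digits vanish modulo w^k and equal p_1^(v mod l_1) u w^(-e) modulo
    p_1^(l_1 k), with v = v_{p_1}(n!) and u the part of n! prime to p_1.  The
    Chinese remainder theorem glues the two residues into [dominant_digits]
    (lemma [ell_dominant]).  This value is p_1-automatic: splitting off the
    multiples of p gives (p n + r)! = p^n n! P(p n + r), where P, the product of
    the non-multiples of p, is periodic modulo prime powers, so a finite amount
    of information about n determines the same information about p n + r
    ([finite_state_fact]).

    If D_1 is strictly the largest, p_1 dominates for all large n, because digit
    sums are sublinear ([strict_dominated]), and the sequence itself is
    p_1-automatic.

    In case of ties, p_1 dominates a tied p_i as soon as s_{p_1}(n) exceeds
    s_{p_i}(n) by a constant ([tie_dominated]).  A base-a digit sum over L digits
    has mean L (a - 1) / 2 and variance of order L, and (a - 1) / log a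
    increases with a; as p_1 is the largest tied prime, Chebyshev's argument
    shows that the exceptions have density zero ([digit_sum_lt_null]), so that
    the sequence still agrees with a p_1-automatic one on a set of density 1.

    For the non-automaticity consider the set Z of those n for which p_1^{l_1}
    divides the value of the sequence.  It avoids the n where p_1 dominates, so
    it has density zero.  Yet it contains arbitrarily long intervals: to the
    right of suitable powers of p_1, the digit sum s_{p_1} is small while s_{p_2}
    is large ([powers_digit_sum_large]), so that p_2 determines the exponent of b
    ([other_prime_dominates]).  An m-automatic set with arbitrarily long
    intervals has positive upper density ([automatic_intervals_not_null]),
    whatever m is: a long interval contains a block [M m^j, (M + 1) m^j), the
    content of such a block depends only on the state of the automaton at M, and
    finitely many M represent all the states. *)

(** * Automatic sequences as finite-state sequences *)

(** An automatic sequence seen through its states.  Asking only that the state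
    at [p * n + r] and the output at [n] be determined by the state at [n]
    avoids writing down a transition table; Boolean or numerical invariants of
    [n] can then serve directly as states. *)
Definition finite_state (p : nat) (T : Type) (alpha : nat -> T) : Prop :=
  exists (S : finType) (s : nat -> S),
    (forall n n' r, r < p -> s n = s n' -> s (p * n + r) = s (p * n' + r)) /\
    (forall n n', s n = s n' -> alpha n = alpha n').

Lemma state_representative (S : finType) (s : nat -> S) :
  exists rep : S -> nat, forall n, s (rep (s n)) = s n.
Proof.
have ex a : exists m, (exists n, s n = a) -> s m = a.
  by case: (pselect (exists n, s n = a)) => [[n sn]|no]; [exists n | exists 0].
have [rep repP] := choice ex.
by exists rep => n; exact: repP (ex_intro _ n erefl).
Qed.

Lemma mkseq_add (T : Type) (f : nat -> T) m n :
  mkseq f (m + n) = mkseq f m ++ mkseq (fun r => f (m + r)) n.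
Proof.
by rewrite /mkseq iotaD map_cat add0n -[in iota m n](addn0 m) iotaDl -map_comp.
Qed.

(** The morphism sends a state to the [p] states reached from it by reading one
    more digit; its value on a state is read off a representative, which is
    harmless since the successors depend only on the state. *)
Lemma finite_state_automatic (p : nat) (T : Type) (alpha : nat -> T) :
  1 < p -> finite_state p alpha -> automatic p alpha.
Proof.
move=> p_gt1 [S [s [stepS outS]]].
have [rep repP] := state_representative s.
pose delta a r := s (p * rep a + r).
pose phi u := flatten [seq mkseq (delta a) p | a <- u].
pose tau u := [seq alpha (rep a) | a <- u].
have phiE n : phi (mkseq s n) = mkseq s (p * n).
  elim: n => [|n IHn]; first by rewrite muln0.
  rewrite -addn1 mkseq_add /phi map_cat flatten_cat -/(phi _) IHn mulnDr muln1.
  rewrite mkseq_add /= cats0 addn0; congr (_ ++ _).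
  apply/eq_in_map => r; rewrite mem_iota => /andP[_ r_lt].
  exact: stepS.
have iterE i : iter i phi [:: s 0] = mkseq s (p ^ i).
  by elim: i => [//|i IHi]; rewrite iterS IHi phiE expnS.
have sizephi u : size (phi u) = p * size u.
  by elim: u => [|a u IHu]; rewrite ?muln0 //= size_cat size_mkseq IHu mulnS.
exists S, phi, (s 0), s, tau; split.
- split; first by move=> u v; rewrite /phi map_cat flatten_cat.
  by split=> [|a]; rewrite ?sizephi ?muln1 // ltnW.
- exists (behead (phi [:: s 0])); split.
    have := phiE 1; rewrite /= muln1 => ->.
    by case: (p) p_gt1 => // q _.
  have size_gt0 i u : 0 < size u -> 0 < size (iter i phi u).
    by move=> u0; elim: i => // i IHi; rewrite iterS sizephi muln_gt0 ltnW.
  move=> i /(congr1 size) /=; apply/eqP; rewrite -lt0n size_gt0 //.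
  by rewrite size_behead sizephi muln1 -subn1 subn_gt0.
- by move=> i; rewrite iterE size_mkseq.
- by split=> [u v|]; [rewrite /tau map_cat | split].
by move=> n; rewrite /tau /=; congr [:: _]; apply: outS.
Qed.

(** The letter of the fixed point at [m * n + r] is the [r]-th letter of the
    image of the letter at [n], so the fixed point itself is the state
    sequence.  A [1]-uniform morphism is never prolongable, whence [1 < m]. *)
Lemma automatic_finite_state (m : nat) (T : Type) (alpha : nat -> T) :
  automatic m alpha -> 1 < m /\ finite_state m alpha.
Proof.
case=> [S [phi [x [w [tau [[phiM [m_gt0 phiU]] [y [phix yN]] omega _ tauE]]]]]].
have m_gt1 : 1 < m.
  rewrite -(phiU x) phix /= ltnS lt0n; apply/negP => /eqP/size0nil y0.
  exact: (yN 0).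
split=> //.
have phi0 : phi [::] = [::].
  by apply: size0nil; have := congr1 size (phiM [::] [::]); rewrite /= size_cat; lia.
have sizephi u : size (phi u) = m * size u.
  elim: u => [|a u IHu]; first by rewrite phi0 muln0.
  by rewrite -cat1s phiM size_cat IHu phiU mulnS.
have nth_phi u j r : r < m -> j < size u ->
    nth x (phi u) (m * j + r) = nth x (phi [:: nth x u j]) r.
  move=> r_lt; elim: u j => [//|a u IHu] [|j] /= j_lt.
    by rewrite muln0 -cat1s phiM nth_cat phiU r_lt.
  rewrite -cat1s phiM nth_cat phiU -IHu //.
  by rewrite ifF; [congr nth; lia | apply/negbTE; lia].
have iterE i : iter i phi [:: x] = mkseq w (m ^ i).
  rewrite omega; congr mkseq.
  by elim: i => [//|i IHi]; rewrite iterS sizephi IHi expnS.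
have wE n r : r < m -> w (m * n + r) = nth x (phi [:: w n]) r.
  move=> r_lt; have n_lt : n < m ^ n by exact: ltn_expl.
  have := nth_phi (mkseq w (m ^ n)) n r r_lt; rewrite size_mkseq nth_mkseq //.
  move=> <- //; rewrite -iterE -iterS iterE nth_mkseq // expnS; nia.
exists S, w; split=> [n n' r r_lt e|n n' e]; first by rewrite !wE // e.
by have := tauE n; rewrite e tauE => -[].
Qed.

(** * Sets of density zero *)

(** Asymptotic density zero without division: [E] stands for the inverse of
    the usual epsilon. *)
Definition null_set (A : pred nat) : Prop :=
  forall E, exists N0, forall N, N0 <= N -> E * count A (iota 0 N) <= N.

Lemma null_set_sub (A B : pred nat) N0 :
  (forall n, N0 <= n -> A n -> B n) -> null_set B -> null_set A.
Proof.
move=> AB nullB E; have [N1 N1P] := nullB (2 * E).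
exists (N0 + N1 + 2 * E * N0) => N NN.
have [d Nd] : exists d, N = N0 + d by exists (N - N0); lia.
have cA0 : count A (iota 0 N0) <= N0.
  by rewrite -{2}(size_iota 0 N0) count_size.
have cAB : count A (iota N0 d) <= count B (iota N0 d).
  rewrite -!size_filter; apply: uniq_leq_size; first by rewrite filter_uniq ?iota_uniq.
  move=> x; rewrite !mem_filter mem_iota => /andP[Ax /andP[x1 x2]].
  by rewrite x1 x2 (AB x).
have cN : count A (iota 0 N) <= N0 + count B (iota 0 N).
  by rewrite Nd !iotaD !count_cat add0n; lia.
have := N1P N; have : N1 <= N by lia.
move=> -> /(_ isT).
have : E * count A (iota 0 N) <= E * N0 + E * count B (iota 0 N).
  by rewrite -mulnDr leq_mul2l cN orbT.
move: NN; rewrite -!mulnA; move: (E * count A _) (E * count B _) (E * N0) => x y z; lia.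
Qed.

Lemma null_set0 : null_set xpred0.
Proof. by move=> E; exists 0 => N _; rewrite count_pred0 muln0. Qed.

Lemma null_setU (A B : pred nat) :
  null_set A -> null_set B -> null_set (fun n => A n || B n).
Proof.
move=> nullA nullB E; have [[N1 N1P] [N2 N2P]] := (nullA (2 * E), nullB (2 * E)).
exists (N1 + N2) => N NN.
have := N1P N; have := N2P N.
have -> : N1 <= N by lia.
have -> : N2 <= N by lia.
have : count (fun n => A n || B n) (iota 0 N) <= count A (iota 0 N) + count B (iota 0 N).
  by rewrite -[X in _ <= X]count_predUI leq_addr.
move: (count _ _) (count A _) (count B _) => cU cA cB le /(_ isT) hB /(_ isT) hA.
have : E * cU <= E * cA + E * cB by rewrite -mulnDr leq_mul2l le orbT.
move: hA hB; rewrite -!mulnA; move: (E * cU) (E * cA) (E * cB) => x y z; lia.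
Qed.

Lemma null_set_has (s : seq nat) (A : nat -> pred nat) :
  (forall i, i \in s -> null_set (A i)) -> null_set (fun n => has (A^~ n) s).
Proof.
elim: s => [|i s IHs] nullA /=; first exact: null_set0.
apply: null_setU; first by apply: nullA; rewrite mem_head.
by apply: IHs => j js; apply: nullA; rewrite inE js orbT.
Qed.

Lemma null_set_density (R : realType) (A : pred nat) :
  null_set (predC A) -> has_density A (1%R : R).
Proof.
move=> nullA; apply/cvgrPdist_le => e e_gt0.
pose E := (Num.truncn (e^-1)%R).+1.
have [N0 N0P] := nullA (2 * E).
exists (N0 + 1) => //= n nN; rewrite /= in nN.
have n_gt0 : 0 < n by lia.
have cC := count_predC A (iota 1 n); rewrite size_iota in cC.
have nR : (0 < n%:R :> R)%R by rewrite ltr0n.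
have -> : (1 - (count A (iota 1 n))%:R / n%:R =
    (count (predC A) (iota 1 n))%:R / n%:R :> R)%R.
  apply: (mulIf (lt0r_neq0 nR)); rewrite mulrBl !divfK ?lt0r_neq0 // mul1r.
  by rewrite -{1}cC natrD addrC addKr.
rewrite ger0_norm ?divr_ge0 // ler_pdivrMr //.
have cnt : E * count (predC A) (iota 1 n) <= n.
  have := N0P n.+1; rewrite /= ; nia.
have Ee : (e^-1 < E%:R)%R by rewrite truncnS_gt // invr_ge0 ltW.
rewrite -ler_pdivrMl //.
apply: le_trans (_ : E%:R * (count (predC A) (iota 1 n))%:R <= _)%R.
  by rewrite ler_wpM2r // ltW.
by rewrite -natrM ler_nat.
Qed.

(** An interval of length [2 m^j] contains a block from [M m^j] to
    [(M + 1) m^j].  Membership in the block depends only on the state at [M], so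
    [M] may be replaced by a representative of its state; representatives are
    bounded by some [K] independent of [j], hence the set fills a proportion at
    least [1 / (K + 1)] of an initial segment, for every [j]. *)
Lemma automatic_intervals_not_null (m : nat) (T : Type) (alpha : nat -> T)
    (Z : pred T) :
  automatic m alpha ->
  (forall B, exists N, forall x, x <= B -> Z (alpha (N + x))) ->
  ~ null_set (fun n => Z (alpha n)).
Proof.
move=> /automatic_finite_state[m_gt1 [S [s [stepS outS]]]] longZ nullZ.
have [rep repP] := state_representative s.
have stepX n n' j x : x < m ^ j -> s n = s n' ->
    s (n * m ^ j + x) = s (n' * m ^ j + x).
  move=> + snn'; elim: j x => [|j IHj] x x_lt.
    by move: x_lt; rewrite expn0 ltnS leqn0 => /eqP->; rewrite !muln1 !addn0.
  have E q : q * m ^ j.+1 + x = m * (q * m ^ j + x %/ m) + x %% m.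
    by rewrite {1}(divn_eq x m) expnS; lia.
  rewrite !E; apply: stepS; first by rewrite ltn_mod ltnW.
  by apply: IHj; rewrite ltn_divLR ?(ltnW m_gt1) // -expnSr.
pose K := \max_(a : S) rep a.
(* The density threshold [N0] also serves as the exponent [j], because then
   [m ^ N0] already exceeds it. *)
have [N0 /(_ (K.+1 * m ^ N0)) N0P] := nullZ K.+2.
have mX_gt : N0 < m ^ N0 by exact: ltn_expl.
have [N NP] := longZ (m ^ N0 + m ^ N0).
pose M := (N %/ m ^ N0).+1.
have MZ x : x < m ^ N0 -> Z (alpha (M * m ^ N0 + x)).
  move=> x_lt; have Nlt : N %% m ^ N0 < m ^ N0 by rewrite ltn_mod; lia.
  have -> : M * m ^ N0 + x = N + (m ^ N0 + x - N %% m ^ N0).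
    by rewrite /M {2}(divn_eq N (m ^ N0)) mulSn; lia.
  by apply: NP; lia.
pose M' := rep (s M).
have M'Z x : x < m ^ N0 -> Z (alpha (M' * m ^ N0 + x)).
  by move=> x_lt; rewrite (outS _ (M * m ^ N0 + x)) ?MZ //; exact: stepX (repP M).
have M'le : M' <= K by exact: (@leq_bigmax_cond _ predT rep).
have cnt : m ^ N0 <= count (fun n => Z (alpha n)) (iota 0 (K.+1 * m ^ N0)).
  have -> : K.+1 * m ^ N0 = M' * m ^ N0 + m ^ N0 + (K - M') * m ^ N0.
    by rewrite -mulSnr -mulnDl; congr (_ * _); lia.
  rewrite !iotaD !count_cat add0n.
  suff -> : count (fun n => Z (alpha n)) (iota (M' * m ^ N0) (m ^ N0)) = m ^ N0.
    lia.
  rewrite -[RHS](size_iota (M' * m ^ N0)); apply/eqP; rewrite -all_count.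
  apply/allP => y; rewrite mem_iota => /andP[y1 y2].
  by rewrite -(subnKC y1); apply: M'Z; lia.
have := N0P; nia.
Qed.

(** * Digit sums *)

(** The sum runs over more positions than [n] has digits; the extra terms
    vanish when [1 < a]. *)
Definition digit_sum (a n : nat) : nat := \sum_(i < n.+1) (n %/ a ^ i) %% a.

Lemma digit_sum_bound a n L : 1 < a -> n < a ^ L ->
  digit_sum a n = \sum_(i < L) (n %/ a ^ i) %% a.
Proof.
move=> a_gt1 n_lt.
have widen K M : n < a ^ K -> K <= M ->
    \sum_(i < M) (n %/ a ^ i) %% a = \sum_(i < K) (n %/ a ^ i) %% a.
  move=> nK /subnKC <-; rewrite big_split_ord /= [X in _ + X]big1 ?addn0 //.
  move=> i _; rewrite divn_small ?mod0n // expnD.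
  by apply: leq_trans nK _; rewrite leq_pmulr // expn_gt0 ltnW.
have n_ltn : n < a ^ n.+1.
  by apply: ltn_trans (ltn_expl n a_gt1) _; rewrite ltn_exp2l.
rewrite /digit_sum; case: (leqP L n.+1) => LE; first exact: widen.
by rewrite (widen n.+1 L) // ltnW.
Qed.

Lemma digit_sumS a n r : 1 < a -> r < a ->
  digit_sum a (a * n + r) = digit_sum a n + r.
Proof.
move=> a_gt1 r_lt; have n_lt : n < a ^ n by exact: ltn_expl.
rewrite (@digit_sum_bound a n n) //.
rewrite (@digit_sum_bound a _ n.+1) //; last by rewrite expnS; nia.
rewrite big_ord_recl expn0 divn1 addnC; congr (_ + _).
  apply: eq_bigr => i _; rewrite lift0 expnS divnMA.
  by rewrite mulnC divnMDl ?(ltnW a_gt1) // [r %/ a]divn_small // addn0.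
by rewrite mulnC modnMDl modn_small.
Qed.

Lemma digit_sum0 a : digit_sum a 0 = 0.
Proof. by rewrite /digit_sum big_ord1 div0n mod0n. Qed.

Lemma digit_ind (a : nat) (a_gt1 : 1 < a) (P : nat -> Prop) : P 0 ->
  (forall n r, r < a -> 0 < a * n + r -> P n -> P (a * n + r)) -> forall n, P n.
Proof.
move=> P0 PS n; elim/ltn_ind: n => -[//|n] IHn.
have lt_mod : n.+1 %% a < a by rewrite ltn_mod ltnW.
have E : n.+1 = a * (n.+1 %/ a) + n.+1 %% a by rewrite mulnC -divn_eq.
have lt_div : n.+1 %/ a < n.+1 by apply: ltn_Pdiv.
by rewrite E; apply: PS; rewrite -?E //; apply: IHn.
Qed.

Lemma digit_sum_succ a n : 1 < a -> digit_sum a n.+1 <= (digit_sum a n).+1.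
Proof.
move=> a_gt1; elim/(digit_ind a_gt1): n => [|n r r_lt _ IHn].
  by have := digit_sumS 0 a_gt1 a_gt1; rewrite muln0 digit_sum0 => ->.
rewrite digit_sumS //; case: (ltnP r.+1 a) => [r1|r1].
  by rewrite -addnS digit_sumS // addnS.
have -> : (a * n + r).+1 = a * n.+1 + 0 by lia.
by rewrite digit_sumS ?(ltnW a_gt1) //; lia.
Qed.

Lemma digit_sum_leD a n x : 1 < a -> digit_sum a (n + x) <= digit_sum a n + x.
Proof.
move=> a_gt1; elim: x => [|x IHx]; first by rewrite !addn0.
by rewrite addnS (leq_trans (digit_sum_succ _ a_gt1)) // addnS ltnS.
Qed.

Lemma digit_sum_exp_le a J x : 1 < a -> digit_sum a (a ^ J + x) <= x.+1.
Proof.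
move=> a_gt1; apply: leq_trans (digit_sum_leD _ _ a_gt1) _.
suff -> : digit_sum a (a ^ J) = 1 by rewrite add1n.
have a_gt0 := ltnW a_gt1.
elim: J => [|J IHJ].
  by have := digit_sumS 0 a_gt1 a_gt1; rewrite muln0 digit_sum0 => ->.
by rewrite expnS -[_ * _]addn0 digit_sumS // IHJ.
Qed.

Lemma digit_sum_gt0 a n : 1 < a -> 0 < n -> 0 < digit_sum a n.
Proof.
move=> a_gt1; elim/(digit_ind a_gt1): n => // n r r_lt n_gt0 IHn _.
by rewrite digit_sumS //; case: n n_gt0 IHn => [|n] n_gt0 IHn; [lia|have := IHn isT; lia].
Qed.

Lemma digit_sum_concat a A x y : 1 < a -> x < a ^ A ->
  digit_sum a (x + a ^ A * y) = digit_sum a x + digit_sum a y.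
Proof.
move=> a_gt1; elim: A x => [|A IHA] x; rewrite ?expn0 ?expnS => x_lt.
  by case: x x_lt => // _; rewrite mul1n digit_sum0.
have r_lt : x %% a < a by rewrite ltn_mod ltnW.
have E z : x + a * z = a * (x %/ a + z) + x %% a.
  by rewrite {1}(divn_eq x a); lia.
rewrite -mulnA E digit_sumS // IHA; last by rewrite ltn_divLR ?(ltnW a_gt1) // mulnC.
by have := E 0; rewrite muln0 !addn0 => {3}->; rewrite digit_sumS //; lia.
Qed.

(** Removing the last [M] digits costs at most [a M], and the remaining number
    [n / a^M] bounds its own digit sum; [M = 2 E] makes [a^M] large enough. *)
Lemma digit_sum_sublinear a C E : 1 < a ->
  exists N0, forall n, N0 <= n -> E * (digit_sum a n + C) <= n.
Proof.
move=> a_gt1; have a_gt0 := ltnW a_gt1.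
have bound M n : digit_sum a n <= a * M + n %/ a ^ M.
  elim: M n => [|M IHM] n.
    rewrite muln0 expn0 divn1 -[X in digit_sum a X]add0n.
    by rewrite (leq_trans (digit_sum_leD _ _ a_gt1)) // digit_sum0.
  have r_lt : n %% a < a by rewrite ltn_mod.
  rewrite {1}(divn_eq n a) mulnC digit_sumS // expnS divnMA.
  by have := IHM (n %/ a); lia.
have M_lt : 2 * E < a ^ (2 * E) by exact: ltn_expl.
exists (2 * E * (a * (2 * E) + C)) => n n_ge.
have := bound (2 * E) n; have : 2 * E * (n %/ a ^ (2 * E)) <= n.
  apply: leq_trans (leq_trunc_div n (a ^ (2 * E))).
  by rewrite mulnC leq_mul2l ltnW ?orbT.
move: (n %/ _) => q; nia.
Qed.

(** Once [p^J + x] fits in [A] base-[a] digits, multiplying [p^J] by [p^(totient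
    (a^A))] leaves those [A] digits unchanged and adds some nonzero digit above
    them; repeating this makes the digit sum as large as desired, uniformly for
    [x <= B]. *)
Lemma powers_digit_sum_large a p B C : 1 < a -> 1 < p -> coprime p a ->
  exists J, forall x, x <= B -> C <= digit_sum a (p ^ J + x).
Proof.
move=> a_gt1 p_gt1 co; elim: C => [|C [J JP]]; first by exists 0.
pose A := p ^ J + B.
have A_lt : A < a ^ A by exact: ltn_expl.
exists (J + totient (a ^ A)) => x x_le.
have tot_gt0 : 0 < totient (a ^ A) by rewrite totient_gt0; lia.
have lt : p ^ J < p ^ (J + totient (a ^ A)) by rewrite ltn_exp2l //; lia.
have : a ^ A %| p ^ (J + totient (a ^ A)) - p ^ J.
  rewrite -eqn_mod_dvd ?(ltnW lt) // expnD -modnMmr.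
  by rewrite Euler_exp_totient ?coprimeXr // modnMmr muln1.
case/dvdnP=> y yE.
have -> : p ^ (J + totient (a ^ A)) + x = p ^ J + x + a ^ A * y.
  by rewrite [a ^ A * y]mulnC -yE; lia.
rewrite digit_sum_concat //; last by apply: leq_ltn_trans A_lt; rewrite /A; lia.
have y_gt0 : 0 < y by case: y yE; lia.
by have := digit_sum_gt0 a_gt1 y_gt0; have := JP x x_le; lia.
Qed.

(** * The second moment of the digit sum *)

(** Twice the deviation of the digit sum from its mean [L (a - 1) / 2] over the
    numbers of at most [L] digits; the factor 2 keeps it an integer. *)
Definition mean_dev (a L n : nat) : int :=
  (2 * (digit_sum a n)%:Z - (L * a.-1)%:Z)%R.

Lemma sum_digit_dev a : (\sum_(0 <= r < a) (2 * r%:Z - a.-1%:Z) = 0 :> int)%R.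
Proof.
have gen c n : (\sum_(0 <= r < n) (2 * r%:Z - c) = n%:Z * (n%:Z - 1 - c) :> int)%R.
  elim: n => [|n IHn]; first by rewrite big_geq // mul0r.
  by rewrite big_nat_recr //= IHn; lia.
rewrite gen; case: a => [|a]; first by rewrite mul0r.
by rewrite -[a.+1]addn1 PoszD /=; lia.
Qed.

Lemma sum_sqr_digit_dev a :
  (\sum_(0 <= r < a) (2 * r%:Z - a.-1%:Z) ^+ 2 <= (a ^ 3)%N%:Z :> int)%R.
Proof.
have -> : ((a ^ 3)%N%:Z = \sum_(0 <= r < a) (a ^ 2)%N%:Z :> int)%R.
  by rewrite sumr_const_nat subn0 expnS mulnC -mulr_natr natz PoszM.
apply: ler_sum_nat => r /andP[_ r_lt].
by rewrite -mulnn PoszM; nia.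
Qed.

Lemma sum_digits (a n : nat) (F : nat -> int) :
  (\sum_(0 <= x < a * n) F x = \sum_(0 <= q < n) \sum_(0 <= r < a) F (a * q + r)%N)%R.
Proof.
elim: n => [|n IHn]; first by rewrite muln0 !big_geq.
rewrite mulnSr (big_cat_nat (n := (a * n)%N)) ?leq_addr //= IHn.
rewrite big_nat_recr //=; congr (_ + _)%R.
by rewrite -{1}[(a * n)%N]add0n big_addn addKn; apply: eq_bigr => r _; rewrite addnC.
Qed.

(** The digits of a uniform number below [a^L] are independent, so variances
    add.  In the induction on [L], peeling off the last digit leaves a cross
    term that vanishes because the deviations of one digit sum to zero. *)
Lemma variance_digit_sum a L : 1 < a ->
  (\sum_(0 <= n < a ^ L) mean_dev a L n ^+ 2 <= (a ^ L * L * a ^ 2)%N%:Z :> int)%R.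
Proof.
move=> a_gt1; elim: L => [|L IHL].
  by rewrite expn0 big_nat1 /mean_dev digit_sum0 mul0n.
rewrite expnS sum_digits.
have step q : (\sum_(0 <= r < a) mean_dev a L.+1 (a * q + r) ^+ 2 =
    a%:Z * mean_dev a L q ^+ 2 + \sum_(0 <= r < a) (2 * r%:Z - a.-1%:Z) ^+ 2)%R.
  rewrite (eq_big_nat _ _ (F2 := fun r => mean_dev a L q ^+ 2 +
     (2 * mean_dev a L q) * (2 * r%:Z - a.-1%:Z) + (2 * r%:Z - a.-1%:Z) ^+ 2))%R.
    rewrite !big_split /= -[X in (_ + X + _)%R]mulr_sumr.
    rewrite sum_digit_dev mulr0 addr0; congr (_ + _)%R.
    by rewrite sumr_const_nat subn0 -mulr_natl natz.
  move=> r /andP[_ r_lt]; rewrite /mean_dev digit_sumS // mulSn !PoszD; ring.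
rewrite (eq_bigr _ (fun q _ => step q)) big_split /= -mulr_sumr sumr_const_nat.
have := sum_sqr_digit_dev a; rewrite subn0 -mulr_natl natz.
have -> : (a ^ 3)%:Z%R = (a%:Z * (a ^ 2)%:Z)%R by rewrite -PoszM -expnS.
move: IHL; set V := (\sum_(_ <= _ < _) _)%R; set W := (\sum_(_ <= _ < _) _)%R.
rewrite -[L.+1]addn1 !PoszM PoszD; move: (a ^ L)%N (a ^ 2)%N V W => x y V W IHL H.
nia.
Qed.

(** * Comparison of digit sums in two bases *)

(** This is the monotonicity of [(a - 1) / log a].  Passing from [a] to [a + 1]
    multiplies the left side by [(1 + 1/a)^Q] with [Q = b - 1], and Bernoulli's
    inequality for [(1 - 1/(a + 1))^Q] bounds this factor by [b] as [Q < a]. *)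
Lemma pred_exp_ltn a b : 1 < b -> b < a -> a ^ b.-1 < b ^ a.-1.
Proof.
case: b => [|Q] //= Q_gt0; elim: a => // a IHa; rewrite ltnS /= => Q_lt.
have bern j : j <= a.+1 -> a.+1 ^ j * (a.+1 - j) <= a ^ j * a.+1.
  elim: j => [|j IHj] j_le; first by rewrite !expn0 subn0.
  have := IHj (ltnW j_le); rewrite !expnSr.
  have -> : a.+1 - j = (a.+1 - j.+1).+1 by lia.
  move: (a.+1 ^ j) (a ^ j) => x y.
  have -> : a.+1 - j.+1 = a - j by lia.
  move: (leq_subr j a); move: (a - j) => z; nia.
have aQ : a ^ Q <= Q.+1 ^ a.-1.
  by move: Q_lt; rewrite leq_eqVlt => /orP[/eqP<- //|/IHa/ltnW].
have step : a.+1 ^ Q < Q.+1 * a ^ Q.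
  have := bern Q _; rewrite (leqW (ltnW Q_lt)) => /(_ isT).
  have : 0 < a.+1 ^ Q by rewrite expn_gt0.
  move: (a.+1 ^ Q) (a ^ Q) => x y x_gt0.
  have [c ->] : exists c, a = Q + c.+1 by exists (a - Q.+1); lia.
  have -> : (Q + c.+1).+1 - Q = c.+2 by lia.
  nia.
apply: leq_trans step _.
have -> : Q.+1 ^ a = Q.+1 * Q.+1 ^ a.-1 by rewrite -expnS prednK //; lia.
by rewrite leq_mul2l aQ orbT.
Qed.

(** The ratio [(y / x)^T] tends to infinity; [T = x^2] suffices for [x > 0] by
    Bernoulli's inequality. *)
Lemma exp_gap x y : x < y -> exists T, x ^ T.+1 <= y ^ T.
Proof.
case: (posnP x) => [->|x_gt0] xy; first by exists 0.
exists (x ^ 2); apply: (@leq_trans (x.+1 ^ (x ^ 2))); last first.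
  by rewrite leq_exp2r // expn_gt0 x_gt0.
have bern n : x ^ n.+1 + n.+1 * x ^ n <= x.+1 ^ n.+1.
  elim: n => [|n IHn]; first by rewrite expn0 !expn1; lia.
  rewrite [x.+1 ^ _]expnS; apply: leq_trans (leq_mul (leqnn x.+1) IHn).
  by rewrite (expnS x n.+1) (expnS x n); move: (x ^ n) => w; nia.
have [n nE] : exists n, x ^ 2 = n.+1.
  by exists (x ^ 2).-1; rewrite prednK // expn_gt0 x_gt0.
have e : n.+1 * x ^ n = x ^ n.+2 by rewrite -[n.+2]add2n expnD nE.
by rewrite nE; apply: leq_trans (bern n); rewrite e leq_addl.
Qed.

(** Markov's inequality for the counting measure. *)
Lemma count_le_sum (A : pred nat) (x : int) (F : nat -> int) N :
  (forall n, 0 <= F n)%R -> (forall n, n < N -> A n -> (x <= F n)%R) ->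
  ((count A (iota 0 N))%:Z * x <= \sum_(0 <= n < N) F n)%R.
Proof.
move=> F0; elim: N => [|N IHN] FA; first by rewrite big_geq // mul0r.
have {}IHN := IHN (fun n h => FA n (ltnW h)).
rewrite -[in iota 0 N.+1]addn1 iotaD count_cat big_nat_recr //= add0n addn0 PoszD mulrDl.
apply: lerD => //; case AN : (A N); first by rewrite mul1r FA.
by rewrite mul0r.
Qed.

(** Let [L1] and [L2] be the numbers of digits needed below [N] in bases [a] and
    [b].  The means [L1 (a - 1) / 2] and [L2 (b - 1) / 2] differ by a positive multiple of
    [L2] ([key], which comes from [pred_exp_ltn] sharpened by [exp_gap]).  If the
    base-[a] digit sum of [n < N] is below the other one plus [C], one of the two
    deviations is therefore of order [L2]; as the variances are of order [L2],
    the proportion of such [n] is of order [1 / L2]. *)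
Lemma digit_sum_lt_null a b C : 1 < b -> b < a ->
  null_set (fun n => digit_sum a n < digit_sum b n + C).
Proof.
move=> b_gt1 ba E; have a_gt1 : 1 < a by lia.
have [T] := exp_gap (pred_exp_ltn b_gt1 ba).
move=> TP; have T_gt0 : 0 < T.
  case: T TP => // ; rewrite expn1 expn0 leqNgt -(expn0 a) ltn_exp2l //; lia.
(* [8 * T ^ 2] comes from [(u - v)^2 <= 2 (u^2 + v^2)] with [u - v] at least
   [L2 / (2 T)], and the cubes from the variance bounds and [a ^ L1 <= a * N].
   Half of [L2] absorbs the lower-order terms listed in [L0]. *)
pose c := 8 * T ^ 2 * (a ^ 3 + b ^ 3).
pose L0 := E * c + 2 * (b.-1 * T.+1 + 2 * C * T) + 1.
exists (b ^ L0) => N N_ge.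
have N_gt1 : 1 < N.
  apply: leq_trans N_ge; rewrite -(expn0 b) ltn_exp2l // /L0; lia.
have /andP[] := up_log_bounds a_gt1 N_gt1; have /andP[] := up_log_bounds b_gt1 N_gt1.
set L1 := up_log a N; set L2 := up_log b N => bL lbL aL laL.
have L2_ge : L0 <= L2 by rewrite -(leq_exp2l _ _ b_gt1) (leq_trans N_ge).
have L12 : L1 <= L2.
  by apply: up_log_min => //; apply: leq_trans lbL _; rewrite leq_exp2r; lia.
have key : b.-1 * T.+1 * L2.-1 <= L1 * a.-1 * T.
  rewrite -(leq_exp2l _ _ a_gt1) (expnM a (_ * _)) (expnM a b.-1).
  apply: (@leq_trans (((b ^ a.-1) ^ T) ^ L2.-1)); first by rewrite leq_exp2r //; lia.
  have lt : b ^ L2.-1 <= a ^ L1 by apply: ltnW; apply: leq_trans bL laL.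
  rewrite -!expnM mulnA [_ * L2.-1]mulnC -[L1 * _ * T]mulnA (expnM b L2.-1) (expnM a L1).
  by rewrite leq_exp2r // muln_gt0 T_gt0; lia.
pose F n := (8 * (T ^ 2)%:Z * (mean_dev a L1 n ^+ 2 + mean_dev b L2 n ^+ 2))%R.
have F0 n : (0 <= F n)%R.
  by rewrite /F; apply: mulr_ge0 => //; apply: addr_ge0; apply: sqr_ge0.
have FA n : n < N -> digit_sum a n < digit_sum b n + C -> ((L2 ^ 2)%:Z <= F n)%R.
  move=> _ bad.
  have : (L2%:Z <= 2 * T%:Z * (mean_dev b L2 n - mean_dev a L1 n))%R.
    rewrite /mean_dev; move: key bad L2_ge; rewrite /L0.
    move: (digit_sum a n) (digit_sum b n) => x y.
    rewrite -[L2.-1]subn1 mulnBr muln1 => key bad L2_ge.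
    have Q_gt0 : 0 < b.-1 by lia.
    have L2_le : L2 <= L2 * b.-1 by rewrite leq_pmulr.
    have {}bad : T * x < T * (y + C) by rewrite ltn_pmul2l.
    move: key bad L2_ge L2_le; rewrite [L1 * a.-1 * T]mulnC -mulnA mulSn mulnDr.
    rewrite [b.-1 * L2]mulnC [b.-1 * (T * L2)]mulnCA [b.-1 * L2]mulnC.
    rewrite -[2 * C * T]mulnA [C * T]mulnC !mulnDr.
    move: (L1 * a.-1) (L2 * b.-1) (E * c) (T * C) => z w ec tc.
    move: (b.-1 * T.+1) => q.
    have -> : (2 * T%:Z * (2 * y%:Z - w%:Z - (2 * x%:Z - z%:Z)) = 4 * (T * y)%N%:Z -
        2 * (T * w)%N%:Z - 4 * (T * x)%N%:Z + 2 * (T * z)%N%:Z :> int)%R.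
      by rewrite !PoszM; ring.
    move: (T * x) (T * y) (T * w) (T * z) => tx ty tw tz; lia.
  rewrite /F; move: (mean_dev a L1 n) (mean_dev b L2 n) => x y.
  rewrite -!mulnn !PoszM; move: (Posz T) => t H.
  apply: le_trans (ler_pM _ _ H H) _ => //.
  rewrite -subr_ge0; set d := (X in (0 <= X)%R).
  by have -> : d = ((2 * t * (x + y)) ^+ 2)%R; [rewrite /d; ring | exact: sqr_ge0].
have := count_le_sum F0 FA.
set A := fun n => _; move: (count A _) => cnt H.
have c_gt0 : 0 < c by rewrite /c !muln_gt0 T_gt0 /= addn_gt0 !expn_gt0; lia.
have sumF : (\sum_(0 <= n < N) F n <= (c * N * L2)%N%:Z)%R.
  have sum_le f L : 1 < f -> N <= f ^ L -> f ^ L.-1 < N -> L <= L2 ->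
      (\sum_(0 <= n < N) mean_dev f L n ^+ 2 <= (f ^ 3 * N * L2)%N%:Z)%R.
    move=> f_gt1 leN ltN leL; apply: le_trans (_ : (f ^ L * L * f ^ 2)%N%:Z <= _)%R.
      apply: le_trans (variance_digit_sum L f_gt1).
      rewrite [leRHS](big_cat_nat (n := N)) //= lerDl.
      by apply: sumr_ge0 => i _; exact: sqr_ge0.
    have L_gt0 : 0 < L by case: (L) leN => //; rewrite expn0; lia.
    have -> : f ^ 3 * N * L2 = f * N * L2 * f ^ 2 by ring.
    rewrite lez_nat !leq_mul //.
    by rewrite -(prednK L_gt0) expnS leq_mul2l ltnW ?orbT.
  rewrite /F -mulr_sumr big_split /=.
  have := sum_le a L1 a_gt1 laL aL L12; have := sum_le b L2 b_gt1 lbL bL (leqnn _).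
  move: (\sum_(_ <= _ < _) _)%R => u; move: (\sum_(_ <= _ < _) _)%R => v Hu Hv.
  have -> : ((c * N * L2)%N%:Z = 8 * (T ^ 2)%N%:Z *
      ((a ^ 3 * N * L2)%N%:Z + (b ^ 3 * N * L2)%N%:Z) :> int)%R.
    by rewrite -PoszD -!PoszM /c; congr Posz; ring.
  by rewrite ler_wpM2l // lerD.
have {H sumF} : cnt * L2 ^ 2 <= c * N * L2.
  by have := le_trans H sumF; rewrite -PoszM lez_nat.
have L2_gt0 : 0 < L2 by apply: leq_trans L2_ge; rewrite /L0; lia.
rewrite -mulnn mulnA leq_pmul2r // => H.
rewrite -(leq_pmul2l c_gt0); apply: leq_trans H.
have Ec : E * c <= L2 by apply: leq_trans L2_ge; rewrite /L0 -!addnA leq_addr.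
by rewrite mulnA [c * E]mulnC mulnC leq_mul2l Ec orbT.
Qed.

(** * The p-part and the p-free part of factorials *)

(** What splitting off the multiples of [p] leaves of [n!].  Modulo a power of
    [p] it is periodic in [n], whereas the whole [p]-free part of [n!] also
    contains the [p]-free part of [(n / p)!]. *)
Definition prime_to_fact (p n : nat) : nat :=
  \prod_(1 <= j < n.+1) (if p %| j then 1 else j).

Lemma prime_to_factS p n :
  prime_to_fact p n.+1 = prime_to_fact p n * (if p %| n.+1 then 1 else n.+1).
Proof. by rewrite /prime_to_fact big_nat_recr. Qed.

Lemma prime_to_fact0 p : prime_to_fact p 0 = 1.
Proof. by rewrite /prime_to_fact big_geq. Qed.

Lemma prime_to_fact_coprime p n : prime p -> coprime p (prime_to_fact p n).
Proof.
move=> p_pr; elim: n => [|n IHn]; first by rewrite prime_to_fact0 coprimen1.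
rewrite prime_to_factS coprimeMr IHn /=; case: ifPn => [_|]; first exact: coprimen1.
by rewrite prime_coprime.
Qed.

Lemma prime_to_fact_gt0 p n : 0 < prime_to_fact p n.
Proof.
elim: n => [|n IHn]; rewrite ?prime_to_fact0 // prime_to_factS muln_gt0 IHn.
by case: ifP.
Qed.

Lemma fact_split_multiples p n : 0 < p ->
  n`! = p ^ (n %/ p) * (n %/ p)`! * prime_to_fact p n.
Proof.
move=> p_gt0; elim: n => [|n IHn].
  by rewrite div0n prime_to_fact0.
rewrite factS IHn prime_to_factS divnS //; case: ifP => [dv|_].
  rewrite add1n expnS factS.
  have : n.+1 = (n %/ p).+1 * p by rewrite -{1}(divnK dv) divnS // dv add1n.
  by move: (n %/ p) => m ->; ring.
by rewrite add0n; ring.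
Qed.

Lemma logn_fact_digit p n r : prime p -> r < p ->
  logn p (p * n + r)`! = n + logn p n`!.
Proof.
move=> p_pr r_lt; have p_gt0 := prime_gt0 p_pr.
rewrite (@fact_split_multiples p) //.
have -> : (p * n + r) %/ p = n by rewrite mulnC divnMDl // divn_small // addn0.
rewrite mulnC logn_Gauss ?prime_to_fact_coprime //.
by rewrite lognM ?fact_gt0 ?expn_gt0 ?p_gt0 // pfactorK.
Qed.

Lemma fact_part_digit p n r : prime p -> r < p ->
  (p * n + r)`!`_p^' = n`!`_p^' * prime_to_fact p (p * n + r).
Proof.
move=> p_pr r_lt; have p_gt0 := prime_gt0 p_pr.
rewrite (@fact_split_multiples p) //.
have -> : (p * n + r) %/ p = n by rewrite mulnC divnMDl // divn_small // addn0.
rewrite !partnM ?muln_gt0 ?fact_gt0 ?expn_gt0 ?p_gt0 ?prime_to_fact_gt0 //.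
rewrite [X in X * _ * _]part_p'nat ?mul1n; last first.
  by rewrite pnatNK pnatX pnat_id.
congr (_ * _); apply: part_pnat_id.
by rewrite p'natE ?prime_to_fact_gt0 // -prime_coprime // prime_to_fact_coprime.
Qed.

Lemma legendre p n : prime p -> logn p n`! * p.-1 + digit_sum p n = n.
Proof.
move=> p_pr; have p_gt1 := prime_gt1 p_pr.
elim/(digit_ind p_gt1): n => [|n r r_lt _ IHn]; first by rewrite fact0 logn1 digit_sum0.
rewrite logn_fact_digit // digit_sumS // mulnDl.
have -> : p * n = n * p.-1 + n.
  by rewrite -{1}(prednK (prime_gt0 p_pr)) mulSn addnC mulnC.
by rewrite -addnA [X in _ + X]addnA IHn addnA.
Qed.

Lemma expn_mod_totient a q e e' : coprime a q -> e = e' %[mod totient q] ->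
  a ^ e = a ^ e' %[mod q].
Proof.
move=> co eq_e.
have red x : a ^ x = a ^ (x %% totient q) %[mod q].
  rewrite {1}(divn_eq x (totient q)) expnD [_ * totient q]mulnC expnM.
  by rewrite -modnMml -modnXm Euler_exp_totient // modnXm exp1n modnMml mul1n.
by rewrite red eq_e -red.
Qed.

(** A shift of [n] by [q] multiplies the product by the constant
    [prime_to_fact p q], a unit modulo [q]; after [totient q] shifts the factor
    is 1. *)
Lemma prime_to_fact_mod p q n n' : coprime (prime_to_fact p q) q -> p %| q ->
  n = n' %[mod q * totient q] -> prime_to_fact p n = prime_to_fact p n' %[mod q].
Proof.
move=> co pq.
have shift m : prime_to_fact p (m + q) = prime_to_fact p m * prime_to_fact p q %[mod q].
  elim: m => [|m IHm]; first by rewrite prime_to_fact0 mul1n.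
  rewrite addSn !prime_to_factS -addSn dvdn_addl // -modnMml IHm modnMml.
  case: ifP => _; first by rewrite !muln1.
  by rewrite -modnMmr modnDr modnMmr; congr (_ %% _); ring.
have shifts m t :
    prime_to_fact p (m + t * q) = prime_to_fact p m * prime_to_fact p q ^ t %[mod q].
  elim: t => [|t IHt]; first by rewrite addn0 muln1.
  by rewrite mulSnr addnA shift -modnMml IHt modnMml expnSr mulnA.
have red x : prime_to_fact p x = prime_to_fact p (x %% (q * totient q)) %[mod q].
  rewrite {1}(divn_eq x (q * totient q)) addnC [q * _]mulnC mulnA shifts.
  rewrite -modnMmr [_ * totient q]mulnC expnM -modnXm Euler_exp_totient //.
  by rewrite modnXm exp1n modnMmr muln1.
by move=> e; rewrite red e -red.
Qed.

(** Truncation at [N] is a finite-state invariant that remembers small [n]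
    exactly, so a sequence may be changed at finitely many places. *)
Lemma minn_digit p n n' r N : 0 < p -> minn n N = minn n' N ->
  minn (p * n + r) N = minn (p * n' + r) N.
Proof.
move=> p_gt0 e; have [-> //|[h h']] : n = n' \/ N <= n /\ N <= n' by lia.
have ge m : N <= m -> minn (p * m + r) N = N.
  move=> Nm; apply/minn_idPr; apply: leq_trans Nm _.
  by apply: leq_trans (leq_addr _ _); rewrite leq_pmull.
by rewrite !ge.
Qed.

(** The state records [n] truncated at [N0], [n] modulo a common period [A], and
    the two residues; reading a digit adds [n] to the valuation and multiplies
    the [p]-free part by a factor depending on [n] modulo [A]. *)
Lemma finite_state_fact p K M N0 (T : Type) (alpha : nat -> T) :
  prime p -> 0 < K -> 0 < M ->
  (forall n n', minn n N0 = minn n' N0 ->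
     logn p n`! = logn p n'`! %[mod M] -> n`!`_p^' = n'`!`_p^' %[mod p ^ K] ->
     alpha n = alpha n') ->
  finite_state p alpha.
Proof.
move=> p_pr K_gt0 M_gt0 alphaE; have p_gt1 := prime_gt1 p_pr.
set q := p ^ K; have q_gt0 : 0 < q by rewrite expn_gt0 ltnW.
have pq : p %| q by rewrite dvdn_exp.
have co : coprime (prime_to_fact p q) q.
  by rewrite coprimeXr // coprime_sym prime_to_fact_coprime.
pose A := M * (q * totient q).
have A_gt0 : 0 < A by rewrite !muln_gt0 M_gt0 q_gt0 totient_gt0.
pose s n : 'I_N0.+1 * 'I_A.+1 * 'I_M.+1 * 'I_q.+1 :=
  (inord (minn n N0), inord (n %% A), inord (logn p n`! %% M), inord (n`!`_p^' %% q)).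
have sE n n' : s n = s n' -> [/\ minn n N0 = minn n' N0, n = n' %[mod A],
    logn p n`! = logn p n'`! %[mod M] & n`!`_p^' = n'`!`_p^' %[mod q]].
  have inj C x y : x <= C -> y <= C -> inord x = inord y :> 'I_C.+1 -> x = y.
    by move=> xC yC /(congr1 val); rewrite /= !inordK.
  by case=> /inj e1 /inj e2 /inj e3 /inj e4; split;
     [apply: e1|apply: e2|apply: e3|apply: e4]; rewrite ?geq_minr // ltnW ?ltn_mod.
exists ('I_N0.+1 * 'I_A.+1 * 'I_M.+1 * 'I_q.+1)%type, s; split; last first.
  by move=> n n' /sE[? _ ? ?]; apply: alphaE.
move=> n n' r r_lt /sE[e1 e2 e3 e4].
have e2' d : d %| A -> p * n + r = p * n' + r %[mod d].
  move=> dA; apply/eqP; rewrite eqn_modDr -modnMmr -[in X in _ == X]modnMmr.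
  by rewrite -(modn_dvdm n dA) e2 modn_dvdm.
have MA : M %| A by apply: dvdn_mulr.
rewrite /s (e2' A) // !logn_fact_digit // !fact_part_digit //.
congr (inord _, _, inord _, inord _).
- by apply: minn_digit; rewrite // prime_gt0.
- apply/eqP; rewrite -modnDm e3; apply/eqP.
  by rewrite -(modn_dvdm n MA) e2 (modn_dvdm _ MA) modnDm.
rewrite -modnMm e4 (@prime_to_fact_mod p q _ (p * n' + r)) ?modnMm //.
by apply: e2'; apply: dvdn_mull.
Qed.

(** * Last nonzero digits of factorials *)

(** The last [k] nonzero base-[p^l w] digits of [n!] when the exponent of the
    base in [n!] is governed by [p]: zero modulo [w^k], and modulo [q] the
    quotient of [n!] by the power of the base, in which [w^(totient q - 1)]
    stands for the inverse of [w]. *)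
Definition dominant_digits (p l w k n : nat) : nat :=
  let q := p ^ (l * k) in
  let v := logn p n`! in
  chinese q (w ^ k)
    ((p ^ (v %% l) * n`!`_p^' * (w ^ (totient q).-1) ^ (v %/ l)) %% q) 0
    %% (q * w ^ k).

Lemma finite_state_dominant_digits p l w k N0 (alpha : nat -> nat) :
  prime p -> 0 < l -> 0 < k -> coprime p w ->
  (forall n, N0 <= n -> alpha n = dominant_digits p l w k n) ->
  finite_state p alpha.
Proof.
move=> p_pr l_gt0 k_gt0 co alphaE; have p_gt0 := prime_gt0 p_pr.
pose q := p ^ (l * k); have q_gt0 : 0 < q by rewrite expn_gt0 p_gt0.
have M_gt0 : 0 < l * totient q by rewrite muln_gt0 l_gt0 totient_gt0.
apply: (@finite_state_fact p (l * k) (l * totient q) N0) => //.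
  by rewrite muln_gt0 l_gt0.
move=> n n' eN eV eU.
have [-> //|[Nn Nn']] : n = n' \/ N0 <= n /\ N0 <= n' by lia.
rewrite !alphaE // /dominant_digits -/q; congr (chinese _ _ _ _ %% _).
move: eV eU; rewrite -/q; move: (logn p n`!) (logn p n'`!) => v v' eV.
move: n`!`_p^' n'`!`_p^' => u u' eU.
have el : v %% l = v' %% l.
  have lM : l %| l * totient q by apply: dvdn_mulr.
  by rewrite -(modn_dvdm v lM) eV modn_dvdm.
have ed : v %/ l = v' %/ l %[mod totient q].
  have red x : (x %/ l) %% totient q = (x %% (l * totient q)) %/ l.
    have E : x = x %/ (l * totient q) * totient q * l + x %% (l * totient q).
      by rewrite -mulnA [totient q * l]mulnC -divn_eq.
    rewrite {1}E divnMDl // modnMDl modn_small //.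
    by rewrite ltn_divLR // [_ * l]mulnC ltn_mod.
  by rewrite !red eV.
have cow : coprime (w ^ (totient q).-1) q by rewrite coprimeXl // coprime_sym coprimeXl.
have eA : p ^ (v' %% l) * u = p ^ (v' %% l) * u' %[mod q].
  by rewrite -modnMmr eU modnMmr.
by rewrite el -modnMm eA (expn_mod_totient cow ed) modnMm.
Qed.

Lemma dominant_valuation p l w k n : prime p -> 0 < l -> 0 < w -> coprime p w ->
  let e := logn p n`! %/ l in
  w ^ (e + k) %| n`! -> nu (p ^ l * w) n`! = e.
Proof.
move=> p_pr l_gt0 w_gt0 co e wn; have n_gt0 := fact_gt0 n.
have p_gt1 := prime_gt1 p_pr.
have b_gt1 : 1 < p ^ l * w.
  by apply: leq_trans (leq_pmulr _ w_gt0); rewrite -(expn0 p) ltn_exp2l.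
have [dv mx] := nuP b_gt1 n_gt0.
apply/eqP; rewrite eqn_leq; apply/andP; split.
  rewrite leq_divRL // mulnC -pfactor_dvdn //; apply: dvdn_trans dv.
  by rewrite expnMn -expnM dvdn_mulr.
apply: mx; rewrite expnMn -expnM Gauss_dvd ?coprimeXl ?coprimeXr //.
rewrite pfactor_dvdn // mulnC leq_trunc_div /=.
by apply: dvdn_trans wn; rewrite expnD dvdn_mulr.
Qed.

Lemma divided_fact_mod p l w k n : prime p -> coprime p w ->
  let e := logn p n`! %/ l in
  w ^ (e + k) %| n`! ->
  n`! %/ (p ^ l * w) ^ e * w ^ e = p ^ (logn p n`! %% l) * n`!`_p^'.
Proof.
move=> p_pr co e wn; have n_gt0 := fact_gt0 n.
have dv : (p ^ l * w) ^ e %| n`!.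
  rewrite expnMn -expnM Gauss_dvd ?coprimeXl ?coprimeXr //.
  rewrite pfactor_dvdn // mulnC leq_trunc_div /=.
  by apply: dvdn_trans wn; rewrite expnD dvdn_mulr.
have pe_gt0 : 0 < p ^ (e * l) by rewrite expn_gt0 prime_gt0.
apply/eqP; rewrite -(eqn_pmul2l pe_gt0); apply/eqP.
have -> : p ^ (e * l) * (n`! %/ (p ^ l * w) ^ e * w ^ e) = n`!.
  rewrite -[RHS](divnK dv) [in X in _ = _ * X]expnMn -expnM [l * e]mulnC; ring.
by rewrite mulnA -expnD -divn_eq -p_part partnC.
Qed.

(** The hypothesis says that the prime powers in [w] occur in [n!] at least [k]
    times more often than [p^l] does.  Nondivisibility by [p^l] is what tells
    these [n] apart from those where another prime governs the exponent. *)
Lemma ell_dominant p l w k n : prime p -> 0 < l -> 0 < k -> 0 < w -> coprime p w ->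
  w ^ (logn p n`! %/ l + k) %| n`! ->
  ell (p ^ l * w) k n`! = dominant_digits p l w k n /\
  ~~ (p ^ l %| ell (p ^ l * w) k n`!).
Proof.
move=> p_pr l_gt0 k_gt0 w_gt0 co wn; have n_gt0 := fact_gt0 n.
have p_gt0 := prime_gt0 p_pr.
have := divided_fact_mod p_pr co wn.
rewrite /ell (dominant_valuation p_pr l_gt0 w_gt0 co wn) /dominant_digits.
move: wn; set q := p ^ (l * k); set v := logn p n`!; set e := v %/ l.
set u := n`!`_p^' => wn; set x := n`! %/ _ => xE.
have bk : (p ^ l * w) ^ k = q * w ^ k by rewrite expnMn -expnM.
have coq : coprime q (w ^ k) by rewrite coprimeXl // coprimeXr.
have u_co : coprime p u.
  by rewrite prime_coprime // -p'natE // part_pnat.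
set w' := w ^ (totient q).-1.
have ww' : w * w' = 1 %[mod q].
  rewrite /w' -expnS prednK ?totient_gt0 ?expn_gt0 ?p_gt0 // Euler_exp_totient //.
  by rewrite coprime_sym coprimeXl.
have xq : x = p ^ (v %% l) * u * w' ^ e %[mod q].
  rewrite -xE -mulnA -expnMn -modnMmr -modnXm ww' modnXm exp1n.
  by rewrite modnMmr muln1.
have xw : w ^ k %| x.
  have fE : n`! = p ^ (e * l) * x * w ^ e.
    by rewrite -mulnA xE mulnA -expnD -divn_eq -p_part partnC.
  move: wn; rewrite fE addnC expnD dvdn_pmul2r ?expn_gt0 ?w_gt0 //.
  by rewrite Gauss_dvdr // coprimeXl // coprimeXr // coprime_sym.
split.
  rewrite bk; apply/eqP; rewrite chinese_remainder //; apply/andP; split; apply/eqP.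
    by rewrite chinese_modl // modn_mod.
  by rewrite chinese_modr // mod0n; apply/eqP.
have -> : (p ^ l %| x %% (p ^ l * w) ^ k) = (p ^ l %| x).
  have dv : p ^ l %| (p ^ l * w) ^ k.
    by rewrite -(prednK k_gt0) expnS -mulnA dvdn_mulr.
  by rewrite /dvdn modn_dvdm.
have co_pw : coprime (p ^ l) (w ^ e) by rewrite coprimeXl // coprimeXr.
rewrite -(Gauss_dvdl _ co_pw) xE Gauss_dvdl ?coprimeXl //.
by rewrite pfactor_dvdn ?expn_gt0 ?p_gt0 // pfactorK // -ltnNge ltn_mod.
Qed.

(** By Legendre's formula both valuations, multiplied by [l (p - 1)], are [n]
    minus a digit sum, so only the digit sums need comparing. *)
Lemma tie_dominated p l p' l' k n : prime p -> prime p' ->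
  l' * p'.-1 = l * p.-1 ->
  digit_sum p' n + l * p.-1 * k <= digit_sum p n ->
  p' ^ (l' * (logn p n`! %/ l + k)) %| n`!.
Proof.
move=> p_pr p'_pr tie ds; have p'_gt1 := prime_gt1 p'_pr.
have p'1 : 0 < p'.-1 by lia.
rewrite pfactor_dvdn ?fact_gt0 // -(leq_pmul2r p'1).
have := legendre n p_pr; have := legendre n p'_pr.
have := leq_trunc_div (logn p n`!) l.
move: (logn p _) (logn p' _) => v v'; move: (v %/ l) => e ev V' V.
have -> : l' * (e + k) * p'.-1 = e * l * p.-1 + l * p.-1 * k.
  by rewrite mulnAC tie; ring.
have : e * l * p.-1 <= v * p.-1 by rewrite leq_mul2r ev orbT.
move: ds V V'; move: (l * p.-1 * k) (e * l * p.-1) (v * _) (v' * _); lia.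
Qed.

(** The main terms [n / (l (p - 1))] and [n / (l' (p' - 1))] already differ by a
    multiple of [n], which absorbs the digit sum of [n]. *)
Lemma strict_dominated p l p' l' k : prime p -> prime p' ->
  l' * p'.-1 < l * p.-1 ->
  exists N0, forall n, N0 <= n -> p' ^ (l' * (logn p n`! %/ l + k)) %| n`!.
Proof.
move=> p_pr p'_pr; set D := l * p.-1 => lt; have p'_gt1 := prime_gt1 p'_pr.
have [N0 N0P] := digit_sum_sublinear (l' * p'.-1 * k) D p'_gt1.
exists N0 => n /N0P ds; have p'1 : 0 < p'.-1 by lia.
rewrite pfactor_dvdn ?fact_gt0 // -(leq_pmul2r p'1).
have D_gt0 : 0 < D by apply: leq_ltn_trans lt.
have := legendre n p_pr; have := legendre n p'_pr.
have := leq_trunc_div (logn p n`!) l.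
move: (logn p _) (logn p' _) => v v'; move: (v %/ l) => e ev V' V.
have De : D * e <= n.
  by rewrite -V mulnC /D mulnA (leq_trans _ (leq_addr _ _)) // leq_mul2r ev orbT.
rewrite mulnAC; move: ds V' lt; move: (l' * p'.-1) (v' * p'.-1) (digit_sum p' n).
move=> D' x s ds V' lt.
have D'e : D * (D' * e) <= D' * n by rewrite mulnCA leq_mul2l De orbT.
have D'n : D' * n + n <= D * n by rewrite -mulSnr leq_mul2r lt orbT.
have : D * (D' * (e + k) + s) <= D * n.
  rewrite [D' * (e + k)]mulnDr -addnA [D' * k + s]addnC mulnDr.
  by apply: leq_trans D'n; apply: leq_add.
by rewrite leq_pmul2l //; lia.
Qed.

(** The exponent of the base in [n!] is at most [v' / l'], which here is less
    than [v / l]; hence a full factor [p^l] survives the division. *)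
Lemma other_prime_dominates p l w k p' l' n : prime p -> prime p' ->
  0 < l -> 0 < k -> 0 < w -> coprime p w -> p' ^ l' %| w ->
  l' * p'.-1 = l * p.-1 ->
  digit_sum p n + l * p.-1 <= digit_sum p' n ->
  p ^ l %| ell (p ^ l * w) k n`!.
Proof.
move=> p_pr p'_pr l_gt0 k_gt0 w_gt0 co p'w tie ds.
have p'_gt1 := prime_gt1 p'_pr; have p_gt1 := prime_gt1 p_pr.
have b_gt1 : 1 < p ^ l * w.
  by apply: leq_trans (leq_pmulr _ w_gt0); rewrite -(expn0 p) ltn_exp2l.
have n_gt0 := fact_gt0 n; have [dv _] := nuP b_gt1 n_gt0.
rewrite /ell; set m := nu _ _ in dv *.
have le' : l' * m <= logn p' n`!.
  rewrite -pfactor_dvdn //; apply: dvdn_trans dv; rewrite expnM.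
  by apply: dvdn_exp2r; apply: dvdn_mull.
have le : l * m.+1 <= logn p n`!.
  have p1 : 0 < p.-1 by lia.
  rewrite -(leq_pmul2r p1).
  have := legendre n p_pr; have := legendre n p'_pr.
  have : l' * m * p'.-1 <= logn p' n`! * p'.-1 by rewrite leq_mul2r le' orbT.
  have -> : l' * m * p'.-1 = l * p.-1 * m by rewrite mulnAC tie.
  have -> : l * m.+1 * p.-1 = l * p.-1 * m + l * p.-1 by ring.
  by move: (l * p.-1 * m) (l * p.-1) ds => x D ds; lia.
have pb : p ^ l %| (p ^ l * w) ^ k by rewrite -(prednK k_gt0) expnS -mulnA dvdn_mulr.
rewrite /dvdn modn_dvdm // -/(dvdn _ _); set x := _ %/ _.
move: le; rewrite -pfactor_dvdn // -(divnK dv) -/x expnMn -expnM.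
rewrite mulnCA mulnS addnC expnD.
rewrite dvdn_pmul2l ?expn_gt0 ?(ltnW p_gt1) // Gauss_dvdl //.
by rewrite coprimeXl // coprimeXr.
Qed.

(** * The characterization *)

Lemma eventually_all (r : nat) (P : nat -> nat -> Prop) :
  (forall i, 2 <= i <= r -> exists N0, forall n, N0 <= n -> P i n) ->
  exists N0, forall n, N0 <= n -> forall i, 2 <= i <= r -> P i n.
Proof.
elim: r => [|r IHr] H; first by exists 0 => n _ i; lia.
have [N1 N1P] : exists N0, forall n, N0 <= n -> forall i, 2 <= i <= r -> P i n.
  by apply: IHr => i ir; apply: H; lia.
case: (leqP 2 r.+1) => r_ge; last by exists 0 => n _ i; lia.
have [N2 N2P] := H r.+1 (introT andP (conj r_ge (leqnn _))).
exists (N1 + N2) => n nN i /andP[i2]; rewrite leq_eqVlt => /orP[/eqP->|ir].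
  by apply: N2P; lia.
by apply: N1P; lia.
Qed.

Lemma coprime_prod_powers (p l : nat -> nat) q m n :
  (forall i, m <= i < n -> coprime q (p i)) ->
  coprime q (\prod_(m <= i < n) p i ^ l i).
Proof.
move=> co; rewrite big_nat_cond; elim/big_rec: _ => [|i x /andP[i_in _] cox].
  exact: coprimen1.
by rewrite coprimeMr cox andbT coprimeXr // co.
Qed.

Lemma dvdn_prod_powers (p l : nat -> nat) r x m :
  (forall i, 1 <= i <= r -> prime (p i)) ->
  (forall i j, 1 <= i <= r -> 1 <= j <= r -> p i = p j -> i = j) ->
  (forall i, 2 <= i <= r -> p i ^ (l i * x) %| m) ->
  (\prod_(2 <= i < r.+1) p i ^ l i) ^ x %| m.
Proof.
move=> hp hinj; elim: r hp hinj => [|r IHr] hp hinj dv.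
  by rewrite big_geq // exp1n dvd1n.
case: (leqP 2 r.+1) => r_ge; last by rewrite big_geq // exp1n dvd1n.
rewrite big_nat_recr //= expnMn -expnM Gauss_dvd.
  apply/andP; split; last by apply: dv; lia.
  by apply: IHr => [i ir|i j ir jr|i ir]; [apply: hp|apply: hinj|apply: dv]; lia.
rewrite coprimeXl // coprime_sym coprimeXl //.
apply: coprime_prod_powers => i ir; rewrite prime_coprime ?hp //; try lia.
rewrite dvdn_prime2 ?hp //; try lia.
by apply/negP => /eqP /hinj e; have := e _ _; lia.
Qed.

Theorem theorem1 (R : realType) (b k r : nat) (p l : nat -> nat)
  (hb : 2 <= b) (hk : 1 <= k) (hr : 1 <= r)
  (hp : forall i, 1 <= i <= r -> prime (p i))
  (hinj : forall i j, 1 <= i <= r -> 1 <= j <= r -> p i = p j -> i = j)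
  (hl : forall i, 1 <= i <= r -> 0 < l i)
  (hfact : b = \prod_(1 <= i < r.+1) p i ^ l i)
  (hord : 2 <= r ->
     (forall i, 1 <= i < r -> l i.+1 * (p i.+1 - 1) <= l i * (p i - 1)) /\
     p 1 = \max_(1 <= i < r.+1 | l i * (p i - 1) == l 1 * (p 1 - 1)) p i) :
  ((r = 1 \/ (2 <= r /\ l 2 * (p 2 - 1) < l 1 * (p 1 - 1))) ->
     automatic (p 1) (fun n => ell b k n`!)) /\
  (2 <= r /\ l 1 * (p 1 - 1) = l 2 * (p 2 - 1) ->
     (forall m, 0 < m -> ~ automatic m (fun n => ell b k n`!)) /\
     (exists beta : nat -> nat, automatic (p 1) beta /\
        has_density (fun n => beta n == ell b k n`!) (1%R : R))).
Proof.
have p1_pr : prime (p 1) by apply: hp.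
have p1_gt1 := prime_gt1 p1_pr.
have l1_gt0 : 0 < l 1 by apply: hl.
have pi_pr i : 2 <= i <= r -> prime (p i) by move=> ir; apply: hp; lia.
have p_neq i : 2 <= i <= r -> p 1 != p i.
  move=> ir; apply/eqP => e; have /(_ e) : p 1 = p i -> 1 = i by apply: hinj; lia.
  lia.
have p_co i : 2 <= i <= r -> coprime (p 1) (p i).
  by move=> ir; rewrite prime_coprime // dvdn_prime2 // ?p_neq ?pi_pr.
pose D i := l i * (p i).-1.
have D_decr i j : 1 <= i -> i <= j <= r -> D j <= D i.
  move=> i1 /andP[]; elim: j => [|j IHj]; first by lia.
  rewrite leq_eqVlt => /orP[/eqP-> //|ij] jr.
  apply: leq_trans (IHj _ (ltnW jr)) => //.
  have r_ge : 2 <= r by lia.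
  by have [/(_ j) + _] := hord r_ge; rewrite !subn1; apply; lia.
pose w := \prod_(2 <= i < r.+1) p i ^ l i.
have bE : b = p 1 ^ l 1 * w by rewrite hfact big_ltn.
have w_gt0 : 0 < w by move: hb; rewrite bE; case: (w) => //; rewrite muln0.
have co : coprime (p 1) w.
  by apply: coprime_prod_powers => i ir; apply: p_co; lia.
have p_dvd_w i : 2 <= i <= r -> p i ^ l i %| w.
  move=> ir; rewrite /w (big_cat_nat (n := i)) ?(big_ltn (m := i)) /=; try lia.
  by rewrite dvdn_mull // dvdn_mulr.
pose good i n := p i ^ (l i * (logn (p 1) n`! %/ l 1 + k)) %| n`!.
have good_w n : (forall i, 2 <= i <= r -> good i n) ->
    w ^ (logn (p 1) n`! %/ l 1 + k) %| n`!.
  by move=> gd; apply: dvdn_prod_powers.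
have good_strict i : 2 <= i <= r -> D i < D 1 -> exists N0, forall n, N0 <= n -> good i n.
  by move=> ir lt; apply: strict_dominated => //; apply: pi_pr.
pose beta := dominant_digits (p 1) (l 1) w k.
rewrite bE; split=> [case_i|[r_ge tie2]].
  have [N0 N0P] : exists N0, forall n, N0 <= n -> forall i, 2 <= i <= r -> good i n.
    apply: eventually_all => i ir; apply: good_strict => //.
    case: case_i => [r1|[r2]]; first by lia.
    by rewrite !subn1; apply: leq_ltn_trans; apply: D_decr; lia.
  apply: finite_state_automatic => //.
  apply: (finite_state_dominant_digits (N0 := N0) p1_pr l1_gt0 hk co) => n nN.
  by have [] := ell_dominant p1_pr l1_gt0 hk w_gt0 co (good_w n (N0P n nN)).
have {}tie2 : D 2 = D 1 by rewrite /D -!subn1.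
pose bad n := has (fun i => ~~ good i n) (iota 2 r.-1).
have bad_null : null_set bad.
  apply: (null_set_has (A := fun i n => ~~ good i n)) => i; rewrite mem_iota => i_in.
  have ir : 2 <= i <= r by lia.
  have : D i <= D 1 by apply: D_decr; lia.
  rewrite leq_eqVlt => /orP[/eqP tie|lt]; last first.
    have [N0 N0P] := good_strict i ir lt.
    by apply: (null_set_sub (N0 := N0)) null_set0 => n /N0P ->.
  have pi_lt : p i < p 1.
    rewrite ltn_neqAle eq_sym p_neq //.
    have [_ ->] := hord r_ge; apply: leq_bigmax_seq.
      by rewrite mem_index_iota; lia.
    by rewrite !subn1; apply/eqP.
  have := digit_sum_lt_null (D 1 * k) (prime_gt1 (pi_pr i ir)) pi_lt.
  apply: (null_set_sub (N0 := 0)) => n _; apply: contraR; rewrite -leqNgt => le.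
  by apply: tie_dominated => //; apply: pi_pr.
have good_notbad n : ~~ bad n -> w ^ (logn (p 1) n`! %/ l 1 + k) %| n`!.
  move=> /hasPn gd; apply: good_w => i ir.
  by apply/negPn; apply: gd; rewrite mem_iota; lia.
split=> [m _ aut|]; last first.
  exists beta; split.
    apply: finite_state_automatic => //.
    exact: (finite_state_dominant_digits (N0 := 0) p1_pr l1_gt0 hk co).
  apply: null_set_density; apply: (null_set_sub (N0 := 0)) bad_null => n _ /=.
  apply: contraR => /good_notbad gd.
  by have [->] := ell_dominant p1_pr l1_gt0 hk w_gt0 co gd.
apply: (automatic_intervals_not_null (Z := fun d => p 1 ^ l 1 %| d) aut).
  move=> B; have r2 : 2 <= 2 <= r by lia.
  have co21 : coprime (p 1) (p 2) by apply: p_co.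
  have p2_gt1 := prime_gt1 (pi_pr 2 r2).
  have [J JP] := powers_digit_sum_large B (B.+1 + D 1) p2_gt1 p1_gt1 co21.
  exists (p 1 ^ J) => x xB.
  apply: (other_prime_dominates p1_pr (pi_pr 2 r2) l1_gt0 hk w_gt0 co (p_dvd_w 2 r2) tie2).
  apply: leq_trans (JP x xB); rewrite leq_add2r.
  by apply: leq_trans (digit_sum_exp_le _ _ p1_gt1) _.
apply: (null_set_sub (N0 := 0)) bad_null => n _ /=; apply: contraLR => /good_notbad gd.
by have [_] := ell_dominant p1_pr l1_gt0 hk w_gt0 co gd.
Qed.
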